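(* Let $\Gamma$ be a co-connected type-II strongly regular graph with parameters $(v,k,\lambda,\mu)$ and eigenvalues $k > r \geqslant s$. Suppose that $$0 < \operatorname{frac}(-k/s) < 1 - \frac{r^2+r}{v-2k+\lambda}.$$ Then $\omega(\Gamma) \leqslant \lfloor -k/s \rfloor$.
   Context: Graphs are finite, simple and undirected. The clique number $\omega(\Gamma)$ is the maximum cardinality of a clique in $\Gamma$. A non-empty (having at least one edge) $k$-regular graph on $v$ vertices is edge-regular with parameters $(v,k,\lambda)$ if every pair of adjacent vertices has precisely $\lambda$ common neighbours. A strongly regular graph with parameters $(v,k,\lambda,\mu)$ is a non-complete edge-regular graph with parameters $(v,k,\lambda)$ such that every pair of distinct non-adjacent vertices has precisely $\mu$ common neighbours. Its adjacency matrix has at most three distinct eigenvalues, denoted $k > r \geqslant s$: $k$ is the valency, and $r$ and $s$ are the largest and smallest eigenvalues different from $k$ (with $r=s$ if there is only one eigenvalue different from $k$). A strongly regular graph is type II if all of its eigenvalues are integers. A graph is co-connected if its complement is connected. For a real number $a$, $\operatorname{frac}(a) := a - \lfloor a \rfloor$. *)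

(* Defs.v *)
From mathcomp Require Import all_boot all_order all_algebra.
From mathcomp Require Import reals.
Set Implicit Arguments.
Unset Strict Implicit.
Unset Printing Implicit Defensive.
Import Order.TTheory GRing.Theory Num.Theory.
Local Open Scope ring_scope.

Definition simple_graph (T : finType) (e : rel T) : Prop :=
  symmetric e /\ irreflexive e.

Definition is_clique (T : finType) (e : rel T) (A : {set T}) : bool :=
  [forall x in A, forall y in A, (x != y) ==> e x y].

Definition clique_number (T : finType) (e : rel T) : nat :=
  (\max_(A : {set T} | is_clique e A) #|A|)%N.

Definition edge_regular (T : finType) (e : rel T) (v k l : nat) : Prop :=
  [/\ exists x y, e x y,
      #|T| = v,
      forall x, #|[set y | e x y]| = k
    & forall x y, e x y -> #|[set z | e x z && e y z]| = l].

Definition complete_graph (T : finType) (e : rel T) : Prop :=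
  forall x y, x != y -> e x y.

Definition strongly_regular (T : finType) (e : rel T) (v k l m : nat) : Prop :=
  [/\ edge_regular e v k l,
      ~ complete_graph e
    & forall x y, x != y -> ~~ e x y -> #|[set z | e x z && e y z]| = m].

Definition compl_graph (T : finType) (e : rel T) : rel T :=
  [rel x y | (x != y) && ~~ e x y].

Definition connected_graph (T : finType) (e : rel T) : Prop :=
  forall x y, connect e x y.

Definition co_connected (T : finType) (e : rel T) : Prop :=
  connected_graph (compl_graph e).

Definition adjacency_matrix (R : realType) (T : finType) (e : rel T) :
    'M[R]_#|T| :=
  \matrix_(i, j) (e (enum_val i) (enum_val j))%:R.

(* The adjacency matrix is real symmetric, so its eigenvalues in R are all of
   its eigenvalues. *)
Definition graph_eigenvalue (R : realType) (T : finType) (e : rel T) (a : R) :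
    bool :=
  eigenvalue (adjacency_matrix R e) a.

Definition type_II (R : realType) (T : finType) (e : rel T) : Prop :=
  forall a : R, graph_eigenvalue e a -> a \is a Num.int.

Definition nonprincipal_eigenvalue (R : realType) (T : finType) (e : rel T)
    (k : nat) (a : R) : bool :=
  graph_eigenvalue e a && (a != k%:R).

Definition is_largest_nonprincipal (R : realType) (T : finType) (e : rel T)
    (k : nat) (r : R) : Prop :=
  nonprincipal_eigenvalue e k r /\
  forall a : R, nonprincipal_eigenvalue e k a -> a <= r.

Definition is_smallest_nonprincipal (R : realType) (T : finType) (e : rel T)
    (k : nat) (s : R) : Prop :=
  nonprincipal_eigenvalue e k s /\
  forall a : R, nonprincipal_eigenvalue e k a -> s <= a.

Definition frac_part (R : realType) (a : R) : R := a - (Num.floor a)%:~R.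

(* Main.v *)
Require Import Defs.
From mathcomp Require Import all_boot all_order all_algebra.
From mathcomp Require Import reals.
From mathcomp Require Import zify ring lra.
Set Implicit Arguments.
Unset Strict Implicit.
Unset Printing Implicit Defensive.
Import Order.TTheory GRing.Theory Num.Theory.
Local Open Scope ring_scope.

(** Write D = -k/s = f + eps with f = floor D and 0 < eps < 1, so that Delsarte's
    bound on cliques is D + 1.  A clique attaining that bound would have every
    outside vertex adjacent to exactly D - r of its members.  If the clique
    number exceeded f there would be a clique B of order exactly
    y = f + 1 = (D + 1) - eps.  Move the expected number of neighbours by the
    same amount, to x = f - r = (D - r) - eps: since r is an integer, so is x,
    and hence (n - x)(n - x - 1) >= 0 for every integer n.  Summing this over
    the vertices outside B, n being the number of neighbours in B, gives a
    nonnegative number.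

    A double count ([clique_count]) evaluates the sum as a polynomial in x, y
    and the parameters, the clique adjacency polynomial.  Along the line
    through (D - r, D + 1) in the direction (1, 1) its cubic terms degenerate,
    and it equals eps * (M * (eps - 1) + r^2 + r) with M = v - 2k + l
    ([clique_polynomial_factor]).  When M > 0 the hypothesis on eps says
    exactly that this is negative, a contradiction.

    It remains to see that M > 0.  The eigenvalue relations r + s = l - m and
    r s = m - k ([eigenvalue_sum_prod]) give M m = r (r + 1) s (s + 1)
    ([common_nonneighbours_mul_mu]), and the degenerate cases disappear: s = 0,
    s = -1 and m = 0 would each make D an integer, while r = 0 means m = k,
    which contradicts the connectedness of the complement
    ([co_connected_mu]). *)

(** * Indicator sums and eigenvectors as functions on the vertices *)

Definition adj (R : realType) (T : finType) (e : rel T) (x y : T) : R :=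
  (e x y)%:R.

Lemma sum_indicator (R : pzSemiRingType) (T : finType) (P : pred T) :
  \sum_x (P x)%:R = #|[set x | P x]|%:R :> R.
Proof.
rewrite -sum1_card natr_sum [RHS]big_mkcond /=; apply: eq_bigr => x _.
by rewrite inE; case: (P x).
Qed.

Lemma sum_delta (R : pzSemiRingType) (T : finType) (F : T -> R) (y : T) :
  \sum_x F x * (x == y)%:R = F y.
Proof.
rewrite (bigD1 y) //= eqxx mulr1 big1 ?addr0 // => x /negPf ->.
by rewrite mulr0.
Qed.

Lemma sum_deltal (R : pzSemiRingType) (T : finType) (F : T -> R) (y : T) :
  \sum_x F x * (y == x)%:R = F y.
Proof. by under eq_bigr do rewrite eq_sym; rewrite sum_delta. Qed.

(** Eigenvectors indexed by the vertices themselves make counting arguments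
    possible without the enumeration that indexes the adjacency matrix. *)
Lemma graph_eigenvalueP (R : realType) (T : finType) (e : rel T) (a : R) :
  reflect (exists2 f : T -> R,
             forall y, \sum_x f x * adj R e x y = a * f y
           & exists x, f x != 0)
          (graph_eigenvalue e a).
Proof.
apply: (iffP eigenvalueP) => [[w wA w0]|[f fA [x0 fx0]]].
- exists (fun x => w 0 (enum_rank x)).
    move=> y; have /rowP/(_ (enum_rank y)) := wA.
    rewrite !mxE => <-; rewrite (reindex (@enum_rank T)) /=; last first.
      by exists enum_val => ? _; rewrite ?enum_rankK ?enum_valK.
    by apply: eq_bigr => x _; rewrite mxE !enum_rankK.
  have [i wi] : exists i, w 0 i != 0.
    apply/existsP; apply: contraNT w0; rewrite negb_exists => /forallP w0.
    by apply/eqP/rowP => i; rewrite mxE; apply/eqP; have := w0 i; rewrite negbK.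
  by exists (enum_val i); rewrite enum_valK.
- exists (\row_i f (enum_val i)).
    apply/rowP => j; rewrite !mxE -fA [RHS](reindex (@enum_val T T)) /=; last first.
      by exists enum_rank => ? _; rewrite ?enum_rankK ?enum_valK.
    by apply: eq_bigr => i _; rewrite !mxE.
  apply/eqP => /rowP/(_ (enum_rank x0)); rewrite !mxE enum_rankK => /eqP.
  by rewrite (negPf fx0).
Qed.

(** * The adjacency algebra of a strongly regular graph *)

Section StronglyRegular.
Variables (R : realType) (T : finType) (e : rel T) (v k l m : nat).
Hypotheses (e_simple : simple_graph e) (e_srg : strongly_regular e v k l m).

Let eC : symmetric e. Proof. by case: e_simple. Qed.
Let eI : irreflexive e. Proof. by case: e_simple. Qed.
Local Notation a := (adj R e).

Lemma sum_adj x : \sum_y a x y = k%:R.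
Proof. by case: e_srg => -[_ _ dk _] _ _; rewrite sum_indicator dk. Qed.

(** The matrix identity A^2 = k I + l A + m (J - I - A), which gives both
    the quadratic satisfied by the eigenvalues and the second moment of the
    neighbour counts. *)
Lemma adj_square x y :
  \sum_z a x z * a z y =
  k%:R * (x == y)%:R + l%:R * a x y + m%:R * (1 - (x == y)%:R - a x y).
Proof.
case: e_srg => -[_ _ dk cl] _ cm.
have -> : \sum_z a x z * a z y = #|[set z | e x z && e y z]|%:R.
  rewrite -sum_indicator; apply: eq_bigr => z _.
  by rewrite /adj (eC z y) -natrM mulnb.
have [<-|xy] := eqVneq x y.
  rewrite /adj eI /=; under eq_finset do rewrite andbb.
  by rewrite dk; ring.
rewrite /adj; have [exy|exy] := boolP (e x y).
  by rewrite cl //=; ring.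
by rewrite cm //=; ring.
Qed.

(** Walks of length 2 from a fixed vertex, counted by their end points. *)
Lemma srg_count :
  k%:R * (k%:R - l%:R - 1) = (v%:R - k%:R - 1) * m%:R :> R.
Proof.
case: (e_srg) => -[[x0 _] cT _ _] _ _.
have : \sum_y \sum_z a x0 z * a z y = k%:R * k%:R.
  rewrite exchange_big /=; under eq_bigr do rewrite -mulr_sumr sum_adj.
  by rewrite -mulr_suml sum_adj.
under eq_bigr do rewrite adj_square.
rewrite !big_split /= sum_deltal -!mulr_sumr !sumrB sum_adj.
have -> : \sum_y (x0 == y)%:R = 1 :> R.
  rewrite -[RHS](sum_deltal (fun=> 1) x0).
  by apply: eq_bigr => y _; rewrite mul1r.
by rewrite sumr_const cT => h; lra.
Qed.

Lemma nonadjacent_pair : exists x y, x != y /\ ~~ e x y.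
Proof.
case: e_srg => _ ncomplete _.
have [/existsP[x /existsP[y /andP[? ?]]]|] :=
  boolP [exists x, exists y, (x != y) && ~~ e x y]; first by exists x, y.
rewrite negb_exists => /forallP h; case: ncomplete => x y xy.
have := h x; rewrite negb_exists => /forallP/(_ y).
by rewrite xy negbK.
Qed.

Lemma mu_le_valency : (m <= k)%N.
Proof.
case: (nonadjacent_pair) => x [y [xy exy]]; case: e_srg => -[_ _ dk _] _ cm.
rewrite -(cm x y) // -(dk x); apply/subset_leq_card/subsetP => z.
by rewrite !inE => /andP[].
Qed.

Lemma lambda_lt_valency : (l < k)%N.
Proof.
case: e_srg => -[[x [y exy]] _ dk cl] _ _.
rewrite -(cl x y) // -(dk x); apply/proper_card/properP; split.
  by apply/subsetP => z; rewrite !inE => /andP[].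
by exists y; rewrite !inE ?eI ?andbF.
Qed.

(** A left eigenvector f with eigenvalue b <> k sums to zero, because
    multiplying f A = b f by the all-ones vector gives k (sum f) = b (sum f).
    So J disappears when [adj_square] is applied to f. *)
Lemma nonprincipal_root (b : R) : nonprincipal_eigenvalue e k b ->
  b ^+ 2 = (l%:R - m%:R) * b + (k%:R - m%:R).
Proof.
case/andP => /graph_eigenvalueP[f fA [y fy]] bk.
have f0 : \sum_x f x = 0.
  have : \sum_y \sum_x f x * a x y = k%:R * \sum_x f x.
    rewrite exchange_big /=; under eq_bigr do rewrite -mulr_sumr sum_adj.
    by rewrite -mulr_suml mulrC.
  under eq_bigr do rewrite fA; rewrite -mulr_sumr => /eqP.
  by rewrite -subr_eq0 -mulrBl mulf_eq0 subr_eq0 (negPf bk) => /eqP.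
apply: (mulIf fy).
have <- : \sum_z (\sum_x f x * a x z) * a z y = b ^+ 2 * f y.
  under eq_bigr do rewrite fA -mulrA; by rewrite -mulr_sumr fA mulrA.
under eq_bigr do rewrite mulr_suml.
rewrite exchange_big /=.
have -> : \sum_x \sum_z f x * a x z * a z y =
  \sum_x ((k%:R - m%:R) * (f x * (x == y)%:R)
      + (l%:R - m%:R) * (f x * a x y) + m%:R * f x).
  apply: eq_bigr => x _; under eq_bigr do rewrite -mulrA.
  by rewrite -mulr_sumr adj_square; ring.
rewrite !big_split /= -!mulr_sumr f0 sum_delta fA; ring.
Qed.

(** The identity (A - b)(A - c) = m J makes every vector u (A - b), with u of
    sum zero, an eigenvector for c or zero.  Taking u to be the difference of
    two vertex indicators kills the sum, and the two vertices are chosen so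
    that a third vertex z, adjacent to exactly one of them, witnesses that
    u (A - b) is nonzero.
    So both roots of X^2 - (l - m) X - (k - m) are eigenvalues once they lie
    in R. *)
Lemma conjugate_root_eigenvalue (b c : R) :
  b + c = l%:R - m%:R -> b * c = m%:R - k%:R -> graph_eigenvalue e c.
Proof.
move=> bDc bMc; case: nonadjacent_pair => y [z [yz eyz]].
have [x ezx] : exists x, e z x.
  have : (0 < k)%N by apply: leq_ltn_trans lambda_lt_valency.
  case: e_srg => -[_ _ dk _] _ _; rewrite -(dk z) card_gt0.
  by case/set0Pn => x; rewrite inE; exists x.
have xz : x != z by apply: contraTneq ezx => ->; rewrite eI.
have yx : y != x by apply: contraNneq eyz => ->; rewrite eC.
pose f w := a x w - a y w - b * ((x == w)%:R - (y == w)%:R).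
apply/graph_eigenvalueP; exists f.
  move=> w; rewrite /f.
  have -> : \sum_u (a x u - a y u - b * ((x == u)%:R - (y == u)%:R)) * a u w =
    \sum_u (a x u * a u w - a y u * a u w
       - b * (a u w * (x == u)%:R - a u w * (y == u)%:R)).
    by apply: eq_bigr => u _; ring.
  rewrite !sumrB -mulr_sumr !sumrB !sum_deltal !adj_square.
  have -> : k%:R = m%:R - b * c by rewrite bMc; ring.
  have -> : l%:R = m%:R + b + c by rewrite -addrA bDc; ring.
  by ring.
exists z; rewrite /f /adj (eC x z) ezx (negPf eyz) (negPf xz) (negPf yz).
by rewrite /= !subr0 mulr0 subr0 oner_eq0.
Qed.

(** If n z is the number of neighbours of z in B, then the sums of n and n^2 over
    all vertices come from the degree and from [adj_square].  The members of B
    all have n z = y - 1, and subtracting their contribution leaves the outside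
    vertices. *)
Lemma clique_count (B : {set T}) (x : R) : is_clique e B ->
  let y := #|B|%:R in
  \sum_(z | z \notin B) (\sum_(u in B) a u z - x) * (\sum_(u in B) a u z - x - 1)
  = x * (x + 1) * (v%:R - y) - 2 * x * y * (k%:R - y + 1)
    + y * (y - 1) * (l%:R - y + 2).
Proof.
move=> /forall_inP clB y; pose n z := \sum_(u in B) a u z.
have aB u w : u \in B -> w \in B -> a u w = 1 - (u == w)%:R.
  move=> uB wB; rewrite /adj; have [<-|uw] := eqVneq u w.
    by rewrite eI subrr.
  have /forall_inP/(_ _ wB)/implyP/(_ uw) -> := clB _ uB.
  by rewrite subr0.
have card_delta w : w \in B -> \sum_(u in B) (u == w)%:R = 1 :> R.
  by move=> wB; rewrite (bigD1 w) //= eqxx big1 ?addr0 // => u /andP[_ /negPf ->].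
have sum1B : \sum_(u in B) 1 = y by rewrite sumr_const.
have nB w : w \in B -> n w = y - 1.
  move=> wB; rewrite /n.
  by under eq_bigr => u uB do rewrite aB //; rewrite sumrB card_delta ?sum1B.
have n1 : \sum_z n z = y * k%:R.
  rewrite exchange_big /=; under eq_bigr do rewrite sum_adj.
  by rewrite sumr_const -[_ *+ #|_|]mulr_natl.
have n2 : \sum_z n z ^+ 2 = y * (k%:R + l%:R * (y - 1)).
  have -> : \sum_z n z ^+ 2 = \sum_(w in B) \sum_(u in B) \sum_z a u z * a z w.
    rewrite exchange_big; under [RHS]eq_bigr do rewrite exchange_big /=.
    rewrite exchange_big /=; apply: eq_bigr => z _.
    rewrite expr2 mulr_suml; apply: eq_bigr => u _.
    by rewrite mulr_sumr; apply: eq_bigr => w _; rewrite /adj (eC z).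
  transitivity (\sum_(w in B) (k%:R + l%:R * (y - 1))); last first.
    by rewrite sumr_const -[_ *+ #|_|]mulr_natl.
  apply: eq_bigr => w wB.
  transitivity (\sum_(u in B) (k%:R * (u == w)%:R + l%:R * a u w)).
    apply: eq_bigr => u uB; rewrite adj_square aB //; ring.
  by rewrite big_split /= -!mulr_sumr card_delta // -/(n w) nB // mulr1.
have total : \sum_z (n z - x) * (n z - x - 1) =
    y * (k%:R + l%:R * (y - 1)) - (2 * x + 1) * (y * k%:R) + x * (x + 1) * v%:R.
  transitivity (\sum_z (n z ^+ 2 - (2 * x + 1) * n z + x * (x + 1))).
    by apply: eq_bigr => z _; ring.
  rewrite big_split sumrB /= -mulr_sumr n1 n2 sumr_const.
  by case: e_srg => -[_ -> _ _] _ _; rewrite -[_ *+ v]mulr_natr.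
move: total; rewrite (bigID (mem B)) /=.
under eq_bigr => w wB do rewrite nB //.
rewrite sumr_const -[_ *+ #|_|]mulr_natr -/y => /(canRL (addKr _)) ->.
by ring.
Qed.

(** If m = k, nonadjacent vertices have the same neighbourhood (one common
    neighbourhood of size k fills both).  Neighbourhoods are then constant along
    paths of the complement, so a vertex y with a neighbour would be its own
    neighbour. *)
Lemma co_connected_mu : co_connected e -> (m < k)%N.
Proof.
move=> coc; rewrite ltn_neqAle mu_le_valency andbT; apply/eqP => mk.
case: (e_srg) => -[[x [y exy]] _ dk _] _ cm.
have nbE u w : compl_graph e u w -> e u =1 e w.
  case/andP => uw euw; move=> z.
  have sub p q : p != q -> ~~ e p q -> e p z -> e q z.
    move=> pq epq epz.
    have /eqP/setP/(_ z) : [set z | e p z && e q z] == [set z | e p z].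
      rewrite eqEcard dk cm // mk leqnn andbT.
      by apply/subsetP => t; rewrite !inE => /andP[].
    by rewrite !inE epz.
  by apply/idP/idP; apply: sub; rewrite // 1?eq_sym // eC.
have cl : closed (compl_graph e) [pred u | e u y].
  by move=> u w /nbE/(_ y); rewrite !inE.
have := closed_connect cl (coc x y).
by rewrite !inE exy eI.
Qed.

End StronglyRegular.

(** * Cliques of prescribed order and integrality *)

Lemma subclique (T : finType) (e : rel T) (n : nat) :
  (n <= clique_number e)%N -> exists2 B : {set T}, is_clique e B & #|B| = n.
Proof.
move=> n_le; have cl0 : is_clique e set0.
  by apply/forall_inP => x; rewrite inE.
have [A clA cA] := eq_bigmax_cond (fun A : {set T} => #|A|)
  (introT card_gt0P (ex_intro _ (set0 : {set T}) cl0) : (0 < #|is_clique e|)%N).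
rewrite /clique_number cA in n_le.
have [B BA cB] : exists2 B : {set T}, B \subset A & #|B| = n.
  exists [set x in take n (enum A)].
    by apply/subsetP => x; rewrite inE => /mem_take; rewrite mem_enum.
  rewrite cardsE (card_uniqP _) ?take_uniq ?enum_uniq //.
  by rewrite size_takel // -cardE.
exists B => //; apply/forall_inP => x /(subsetP BA) xA.
apply/forall_inP => y /(subsetP BA) yA.
by have /forall_inP/(_ _ yA) := forall_inP clA _ xA.
Qed.

Lemma int_consecutive_ge0 (R : archiRealDomainType) (p : R) :
  p \is a Num.int -> 0 <= p * (p - 1).
Proof.
case/intrP => i ->; rewrite -[1]/(1%:~R) -rmorphB -rmorphM /= ler0z.
case: (ltrP 0 i) => i0; first by rewrite mulr_ge0 ?subr_ge0 // (ltW i0).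
by rewrite mulr_le0 // subr_le0 (le_trans i0).
Qed.

Lemma frac_part_int (R : realType) (b : R) : b \is a Num.int -> frac_part b = 0.
Proof. by rewrite intrEfloor /frac_part => /eqP ->; rewrite subrr. Qed.

(** * Evaluation of the clique adjacency polynomial *)

(** Everything is expressed through r, s and D: m = -s (D - r) and
    v = (-s D - r)(D + 1)/(D - r).  The left-hand side vanishes at eps = 0, where
    x and y take the values for a clique meeting Delsarte's bound.  Its cubic
    part -y (x - y)^2 is linear in eps, because x - y is constant, so only a
    quadratic in eps with leading coefficient v - 2k + l is left. *)
Lemma clique_polynomial_factor (R : fieldType) (v k l m r s D eps : R) :
  m != 0 -> r + s = l - m -> r * s = m - k -> k = - s * D ->
  k * (k - l - 1) = (v - k - 1) * m ->
  let y := D - eps + 1 in let x := D - eps - r in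
  x * (x + 1) * (v - y) - 2 * x * y * (k - y + 1) + y * (y - 1) * (l - y + 2)
  = eps * ((v - 2 * k + l) * (eps - 1) + (r ^+ 2 + r)).
Proof.
move=> m0 rDs rMs kE cnt y x.
have lE : l = r + s + m by rewrite rDs; ring.
have mE : m = - s * (D - r).
  have -> : m = r * s + k by rewrite rMs; ring.
  by rewrite kE; ring.
have Dr : D - r != 0 by apply: contraNneq m0 => h; rewrite mE h mulr0.
have s0 : s != 0 by apply: contraNneq m0 => h; rewrite mE h oppr0 mul0r.
have vE : v = (- s * D - r) * (D + 1) / (D - r).
  have -> : v = k * (k - l - 1) / m + k + 1 by rewrite cnt; field.
  by rewrite lE mE kE; field; rewrite Dr oppr_eq0.
by rewrite /x /y vE lE mE kE; field.
Qed.

(** The number v - 2k + l counts the vertices adjacent to neither end of an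
    edge; this formula decides when it is positive. *)
Lemma common_nonneighbours_mul_mu (R : comPzRingType) (v k l m r s : R) :
  r + s = l - m -> r * s = m - k ->
  k * (k - l - 1) = (v - k - 1) * m ->
  (v - 2 * k + l) * m = r * (r + 1) * (s * (s + 1)).
Proof.
move=> rDs rMs cnt.
have lE : l = r + s + m by rewrite rDs; ring.
have kE : k = m - r * s by rewrite rMs; ring.
have -> : (v - 2 * k + l) * m = k * (k - l - 1) + (1 - k + l) * m by rewrite cnt; ring.
by rewrite lE kE; ring.
Qed.

(** * The clique bound *)

(** Both r and s are roots of X^2 - (l - m) X - (k - m), which settles the case
    r <> s.  If r = s, the other root c is an eigenvalue too.  Either c = k,
    which forces s = -1 (a disjoint union of complete graphs), or c is
    nonprincipal, hence equal to s, and then s^2 = m - k <= 0 forces s = 0. *)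
Lemma eigenvalue_sum_prod (R : realType) (T : finType) (e : rel T)
    (v k l m : nat) (r s : R) :
  simple_graph e -> strongly_regular e v k l m ->
  is_largest_nonprincipal e k r -> is_smallest_nonprincipal e k s ->
  s != 0 -> s != -1 ->
  r + s = l%:R - m%:R /\ r * s = m%:R - k%:R.
Proof.
move=> e_simple e_srg [r_eig r_max] [s_eig s_min] s0 s1.
have r_root := nonprincipal_root e_simple e_srg r_eig.
have s_root := nonprincipal_root e_simple e_srg s_eig.
have [rs|rs] := eqVneq r s; last first.
  have rDs : r + s = l%:R - m%:R.
    have rs0 : r - s != 0 by rewrite subr_eq0.
    by apply: (mulIf rs0); lra.
  by split=> //; have : s = l%:R - m%:R - r by [lra]; move=> ->; lra.
exfalso; subst r; pose c := l%:R - m%:R - s.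
have sMc : s * c = m%:R - k%:R by rewrite /c; lra.
have sDc : s + c = l%:R - m%:R by rewrite /c; ring.
have c_eig := conjugate_root_eigenvalue e_simple e_srg sDc sMc.
have mk : m%:R <= k%:R :> R by rewrite ler_nat (mu_le_valency e_srg).
have m0 : 0 <= m%:R :> R by rewrite ler0n.
have lk : l%:R + 1 <= k%:R :> R.
  by rewrite natr1 ler_nat (lambda_lt_valency e_simple e_srg).
have l0 : 0 <= l%:R :> R by rewrite ler0n.
have [ck|ck] := eqVneq c k%:R.
  have s_le : s + 1 <= 0 by move: ck; rewrite /c; lra.
  have /eqP : (s + 1) * k%:R = 0.
    apply/eqP; rewrite eq_le mulr_le0_ge0 ?ler0n //=.
    by rewrite ck in sMc; lra.
  rewrite mulf_eq0 => /orP[/eqP|/eqP]; last by lra.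
  by move=> h; case/eqP: s1; lra.
have c_np : nonprincipal_eigenvalue e k c by rewrite /nonprincipal_eigenvalue c_eig.
have cs : c = s by apply/eqP; rewrite eq_le r_max // s_min.
case/negP: s0; rewrite -sqrf_eq0 eq_le sqr_ge0 andbT.
by rewrite expr2 -{2}cs sMc; lra.
Qed.

Theorem theorem2p4 (R : realType) (T : finType) (e : rel T)
    (v k l m : nat) (r s : R)
    (e_simple : simple_graph e)
    (e_srg : strongly_regular e v k l m)
    (e_coconn : co_connected e)
    (e_typeII : type_II R e)
    (r_largest : is_largest_nonprincipal e k r)
    (s_smallest : is_smallest_nonprincipal e k s)
    (frac_gt0 : 0 < frac_part (- (k%:R / s)))
    (frac_lt : frac_part (- (k%:R / s))
               < 1 - (r ^+ 2 + r) / (v%:R - 2 * k%:R + l%:R)) :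
  (clique_number e)%:Z <= Num.floor (- (k%:R / s)).
Proof.
have [rI sI] : r \is a Num.int /\ s \is a Num.int.
  by case: r_largest s_smallest => /andP[/e_typeII ? _] _ [/andP[/e_typeII ? _] _].
set D := - (k%:R / s) in frac_gt0 frac_lt *.
have D_nint : D \isn't a Num.int.
  by apply: contraTN frac_gt0 => /frac_part_int ->; rewrite ltxx.
have s0 : s != 0.
  by apply: contraNneq D_nint => s0; rewrite /D s0 invr0 mulr0 oppr0 rpred0.
have s1 : s != -1.
  by apply: contraNneq D_nint => s1; rewrite /D s1 invrN1 mulrN1 opprK natr_int.
have kE : k%:R = - s * D by rewrite /D; field.
have [rDs rMs] := eigenvalue_sum_prod e_simple e_srg r_largest s_smallest s0 s1.
have m0 : m%:R != 0 :> R.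
  apply: contraNneq D_nint => m0.
  have : s * (D - r) = 0 by rewrite mulrBr; lra.
  by move/eqP; rewrite mulf_eq0 (negPf s0) subr_eq0 /= => /eqP ->.
have m_gt0 : 0 < m%:R :> R by rewrite lt_neqAle eq_sym m0 ler0n.
have mk : m%:R < k%:R :> R by rewrite ltr_nat (co_connected_mu e_simple e_srg).
have sr : s <= r by case: s_smallest r_largest => _ smin [/smin].
have s_lt0 : s < 0.
  rewrite lt_neqAle s0 leNgt; apply/negP => s_gt0.
  by have := mulr_ge0 (le_trans (ltW s_gt0) sr) (ltW s_gt0); lra.
have r_gt0 : 0 < r.
  rewrite ltNge; apply/negP => r_le0.
  by have := mulr_le0 r_le0 (ltW s_lt0); lra.
(* As s is a negative integer other than -1, s <= -2. *)
have s_lt1 : s + 1 < 0.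
  case/intrP: sI s_lt0 s1 => i ->.
  rewrite -[1]/(1%:~R) -rmorphN -rmorphD /= !ltrz0 eqr_int.
  by clear; lia.
have cnt := srg_count R e_simple e_srg.
have M_gt0 : 0 < v%:R - 2 * k%:R + l%:R :> R.
  rewrite -(pmulr_lgt0 _ m_gt0) (common_nonneighbours_mul_mu rDs rMs cnt).
  apply: mulr_gt0; last by rewrite nmulr_rgt0.
  by rewrite mulr_gt0 ?addr_gt0.
have D_ge0 : 0 <= D by rewrite /D -mulrN -invrN mulr_ge0 ?ler0n // invr_ge0; lra.
rewrite leNgt; apply/negP => f_lt.
have f_ge0 : 0 <= Num.floor D by rewrite floor_ge0.
have [B clB cB] : exists2 B : {set T}, is_clique e B & #|B| = `|Num.floor D|.+1%N.
  by apply: subclique; rewrite -ltz_nat gez0_abs.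
set eps := frac_part D in frac_gt0 frac_lt.
have fE : (Num.floor D)%:~R = D - eps by rewrite /eps /frac_part subKr.
have yE : #|B|%:R = D - eps + 1 :> R.
  by rewrite cB -natr1 -fE natr_absz ger0_norm.
have := clique_count e_simple e_srg (D - eps - r) clB.
rewrite /= yE (clique_polynomial_factor eps m0 rDs rMs kE cnt) => sumE.
have : eps * ((v%:R - 2 * k%:R + l%:R) * (eps - 1) + (r ^+ 2 + r)) < 0.
  rewrite pmulr_rlt0 //; move: frac_lt.
  by rewrite ltrBrDl -ltrBrDr ltr_pdivrMr //; lra.
rewrite -sumE ltNge => /negP; apply; apply: sumr_ge0 => z _.
apply: int_consecutive_ge0.
rewrite rpredB ?rpred_sum //; first by move=> u _; exact: natr_int.
by rewrite -fE rpredB ?intr_int.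
Qed.
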